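(* Let $(G,\cdot,\dots)$ be a Hausdorff topological group equipped with some first-order structure, and let $b\colon G\to bG$ be its Bohr compactification. Let $\{U_i\}_{i\in I}$ be a family of open subsets of $bG$ such that (1) $\{U_i\}_{i\in I}$ is a basis of the topology at the identity of $bG$, closed under finite intersections; (2) for every $i\in I$ there is $j\in I$ such that $\overline{U_j}^2\subseteq U_i$, and $U_i=U_i^{-1}$; (3) $x^{-1}U_ix=U_i$ for all $i\in I$ and $x\in bG$. Assume that the von Neumann radical $\mathcal{R}_{vN}(G)$ and all the sets $V_i=b^{-1}(U_i)$, $i\in I$, are definable in $(G,\cdot,\dots)$. Let $G^*$ be a sufficiently saturated elementary extension of $(G,\cdot,\dots)$, let $V_i^*$ be the interpretation of $V_i$ in $G^*$, and put $H=\bigcap_{i\in I}V_i^*$. Then the natural map $G\to G^*/H$ is the Bohr compactification of $G$. Furthermore, any compactification of $G$ is of the form $G\to G^*/H'$ for some normal subgroup $H'$ of $G^*$ that is type-definable over $G$ and contains $H$.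
   Context: A compactification of a topological group $G$ is a continuous homomorphism with dense image from $G$ into a compact Hausdorff topological group. The Bohr compactification $b\colon G\to bG$ is the universal one: every compactification $f\colon G\to\widetilde G$ factors uniquely as $f=\widetilde f\circ b$ with $\widetilde f\colon bG\to\widetilde G$ a continuous surjective homomorphism. The von Neumann radical is $\mathcal{R}_{vN}(G)=\ker(b)$. Compactifications are identified up to topological isomorphism commuting with the maps from $G$. ''Sufficiently saturated'' means $\kappa$-saturated and $\kappa$-strongly homogeneous for a sufficiently big cardinal $\kappa$; small means of cardinality $<\kappa$; bounded index means index $<\kappa$. For a normal subgroup $N$ of $G^*$ of bounded index, type-definable over a small set, the quotient $G^*/N$ carries the logic topology: a subset is closed iff its preimage in $G^*$ is type-definable over a small set of parameters. With this topology $G^*/N$ is a compact Hausdorff group. Bars denote topological closure in $bG$. *)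

(* Defs.v *)
From HB Require Import structures.
From mathcomp Require Import all_boot.
From mathcomp Require Import boolp classical_sets functions cardinality.
From mathcomp Require Import topology.

Set Implicit Arguments.
Unset Strict Implicit.
Unset Printing Implicit Defensive.

Local Open Scope classical_set_scope.
Local Open Scope group_scope.
Local Open Scope quotient_scope.

(* Cardinals are represented by types (or sets), compared by injections. *)
Definition card_lt (T U : Type) (A : set T) (B : set U) : Prop :=
  (A #<= B)%card /\ ~ (B #<= A)%card.

Record language := Language {
  fsym : Type;
  fsym_arity : fsym -> nat;
  rsym : Type;
  rsym_arity : rsym -> nat }.

Record structure (L : language) (M : Type) := Structure {
  fsym_interp : forall f : fsym L, ('I_(fsym_arity f) -> M) -> M;
  rsym_interp : forall r : rsym L, ('I_(rsym_arity r) -> M) -> Prop }.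

Inductive term (L : language) (X : Type) :=
  | Var of X
  | App (f : fsym L) of ('I_(fsym_arity f) -> term L X).

(* [formula L X] is the type of L-formulas with free variables in X.  In
   [All phi] the quantified variable is [None] and the other free variables of
   phi are the [Some x]. *)
Inductive formula (L : language) (X : Type) :=
  | Bot
  | Eq of term L X & term L X
  | Rel (r : rsym L) of ('I_(rsym_arity r) -> term L X)
  | Imp of formula L X & formula L X
  | All of formula L (option X).

Section Semantics.
Variables (L : language) (M : Type) (S : structure L M).

Fixpoint eval (X : Type) (v : X -> M) (t : term L X) : M :=
  match t with
  | Var x => v x
  | App f ts => fsym_interp S (fun i => eval v (ts i))
  end.

Fixpoint sat (X : Type) (v : X -> M) (phi : formula L X) : Prop :=
  match phi with
  | Bot => False
  | Eq t u => eval v t = eval v u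
  | Rel r ts => rsym_interp S (fun i => eval v (ts i))
  | Imp phi psi => sat v phi -> sat v psi
  | All psi => forall x : M, sat (oapp v x) psi
  end.

(* A formula in one variable with parameters from P is a [formula L (option P)]:
   [None] is the variable and [Some a] names the parameter a, which denotes c a.
   [solutions c phi] is the subset of M it defines. *)
Definition solutions (P : Type) (c : P -> M) (phi : formula L (option P)) : set M :=
  [set x | sat (oapp c x) phi].

Definition definable (X : set M) : Prop :=
  exists phi : formula L (option M), X = solutions id phi.

Definition type_definable_over (A : set M) (X : set M) : Prop :=
  exists p : set (formula L (option A)),
    X = \bigcap_(phi in p) solutions (val : A -> M) phi.

Definition small (kappa : Type) (A : set M) : Prop := card_lt A [set: kappa].

Definition small_type_definable (kappa : Type) (X : set M) : Prop :=
  exists A : set M, small kappa A /\ type_definable_over A X.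

Definition saturated (kappa : Type) : Prop :=
  forall (A : set M) (p : set (formula L (option A))),
    small kappa A ->
    (forall q, finite_set q -> q `<=` p ->
       \bigcap_(phi in q) solutions (val : A -> M) phi !=set0) ->
    \bigcap_(phi in p) solutions (val : A -> M) phi !=set0.

Definition automorphism (g : M -> M) : Prop :=
  [/\ bijective g,
      forall f v, g (fsym_interp S (f := f) v) = fsym_interp S (g \o v)
    & forall r v, rsym_interp S (r := r) v <-> rsym_interp S (g \o v)].

End Semantics.

(* The families c and d, indexed by P, have the same type: no L-formula
   distinguishes them. *)
Definition same_type (L : language) (M N : Type) (S : structure L M)
    (T : structure L N) (P : Type) (c : P -> M) (d : P -> N) : Prop :=
  forall phi : formula L P, sat S c phi <-> sat T d phi.

Definition elementary_embedding (L : language) (M N : Type) (S : structure L M)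
    (T : structure L N) (j : M -> N) : Prop :=
  same_type S T id j.

Definition strongly_homogeneous (L : language) (M : Type) (S : structure L M)
    (kappa : Type) : Prop :=
  forall (A : set M) (f : A -> M),
    small kappa A -> same_type S S (val : A -> M) f ->
    exists g : M -> M, automorphism S g /\ forall a : A, g (val a) = f a.

(* The interpretation X^* in N of a definable subset X of M, for an elementary
   embedding j : M -> N.  When X is definable the choice of phi is irrelevant. *)
Definition interpretation (L : language) (M N : Type) (S : structure L M)
    (T : structure L N) (j : M -> N) (X : set M) : set N :=
  [set y | exists phi : formula L (option M),
             X = solutions S id phi /\ solutions T j phi y].

(* L together with a binary function symbol [None] for the multiplication. *)
Definition group_language (L : language) : language :=
  @Language (option (fsym L)) (oapp (@fsym_arity L) 2) (rsym L) (@rsym_arity L).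

Definition group_structure (L : language) (G : groupType) (S : structure L G) :
    structure (group_language L) G :=
  @Structure (group_language L) G
    (fun f : option (fsym L) =>
       match f return ('I_(oapp (@fsym_arity L) 2 f) -> G) -> G with
       | None => fun v => v ord0 * v ord_max
       | Some f => fun v => fsym_interp S v
       end)
    (@rsym_interp L G S).

Record normal_subgroup (G : groupType) (N : set G) : Prop := NormalSubgroup {
  nsubg1 : N 1;
  nsubgM : forall x y, N x -> N y -> N (x * y);
  nsubgV : forall x, N x -> N x^-1;
  nsubgJ : forall x y, N x -> N (x ^ y) }.

Section Quotient.
Variables (G : groupType) (N : set G) (hN : normal_subgroup N).

Definition same_coset of normal_subgroup N : rel G :=
  fun x y => `[< N (x^-1 * y) >].

Fact same_coset_equiv : equiv_class_of (same_coset hN).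
Proof.
split=> [x|x y|y x z].
- by apply/asboolP; rewrite mulVg; exact: nsubg1.
- by apply/asboolP/asboolP => /(nsubgV hN); rewrite invgM invgK.
- move=> /asboolP xy /asboolP yz; apply/asboolP.
  by have := nsubgM hN xy yz; rewrite mulgA mulgK.
Qed.

Canonical same_coset_rel := EquivRelPack same_coset_equiv.

Definition quotient : Type := {eq_quot same_coset_rel}.
HB.instance Definition _ := Choice.on quotient.
HB.instance Definition _ := EqQuotient.on quotient.

Definition quotient_map (x : G) : quotient := \pi_quotient x.

Fact quotient_mapP x y : quotient_map x = quotient_map y <-> N (x^-1 * y).
Proof.
split=> [/eqmodP/asboolP //|xy]; apply/eqmodP; exact/asboolP.
Qed.

Fact quotient_mapW (P : quotient -> Prop) :
  (forall x, P (quotient_map x)) -> forall a, P a.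
Proof. exact: quotW. Qed.

Definition quotient1 : quotient := quotient_map 1.
Definition quotientV (a : quotient) : quotient := quotient_map (repr a)^-1.
Definition quotientM (a b : quotient) : quotient := quotient_map (repr a * repr b).

Fact repr_quotient_map x : N ((repr (quotient_map x))^-1 * x).
Proof. by apply/quotient_mapP; rewrite /quotient_map reprK. Qed.

Fact quotientM_map x y :
  quotientM (quotient_map x) (quotient_map y) = quotient_map (x * y).
Proof.
apply/quotient_mapP; rewrite invgM.
set v := repr _; set u := repr _.
have := nsubgM hN (nsubgJ hN v (repr_quotient_map x)) (repr_quotient_map y).
by rewrite -/u -/v /conjg !mulgA mulgK.
Qed.

Fact quotientV_map x : quotientV (quotient_map x) = quotient_map x^-1.
Proof.
apply/quotient_mapP; rewrite invgK.
set u := repr _.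
have := nsubgV hN (nsubgJ hN u^-1 (repr_quotient_map x)).
by rewrite -/u /conjg invgK !mulgA mulgV mul1g invgM invgK.
Qed.

Fact quotientMA : associative quotientM.
Proof.
elim/quotient_mapW => x; elim/quotient_mapW => y; elim/quotient_mapW => z.
by rewrite !quotientM_map mulgA.
Qed.

Fact quotient1M : left_id quotient1 quotientM.
Proof. by elim/quotient_mapW => x; rewrite quotientM_map mul1g. Qed.

Fact quotientM1 : right_id quotient1 quotientM.
Proof. by elim/quotient_mapW => x; rewrite quotientM_map mulg1. Qed.

Fact quotientVM : left_inverse quotient1 quotientV quotientM.
Proof. by elim/quotient_mapW => x; rewrite quotientV_map quotientM_map mulVg. Qed.

Fact quotientMV : right_inverse quotient1 quotientV quotientM.
Proof. by elim/quotient_mapW => x; rewrite quotientV_map quotientM_map mulgV. Qed.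

HB.instance Definition _ := isGroup.Build quotient
  quotientMA quotient1M quotientM1 quotientVM quotientMV.

Definition bounded_index (kappa : Type) : Prop :=
  card_lt [set: quotient] [set: kappa].

Definition logic_closed (kappa : Type) (L : language) (S : structure L G)
    (C : set quotient) : Prop :=
  small_type_definable S kappa (quotient_map @^-1` C).

End Quotient.

#[short(type="preTopologicalGroupType")]
HB.structure Definition PreTopologicalGroup := {G of Group G & Topological G}.

(* [quotient hN] with the coarsest topology in which the logic-closed sets are
   closed.  For a type-definable N of bounded index in a saturated structure,
   there are no other closed sets; this is [has_logic_topology]. *)
Definition logic_quotient (kappa : Type) (L : language) (G : groupType)
  (S : structure L G) (N : set G) (hN : normal_subgroup N) : Type := quotient hN.

Section LogicQuotient.
Variables (kappa : Type) (L : language) (G : groupType) (S : structure L G).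
Variables (N : set G) (hN : normal_subgroup N).
Local Notation Q := (logic_quotient kappa S hN).

HB.instance Definition _ := Group.on Q.
HB.instance Definition _ := isSubBaseTopological.Build Q
  (logic_closed kappa S (hN := hN)) (fun C => ~` C).

Definition has_logic_topology : Prop :=
  forall C : set Q, closed C <-> logic_closed kappa S C.

Definition natural_map (M : Type) (j : M -> G) : M -> Q :=
  fun x => quotient_map hN (j x).

End LogicQuotient.

Definition topological_group (G : preTopologicalGroupType) : Prop :=
  continuous (fun xy : G * G => xy.1 * xy.2) /\ continuous (fun x : G => x^-1).

Definition compactification (G K : preTopologicalGroupType) (f : G -> K) : Prop :=
  [/\ topological_group K, compact [set: K] & hausdorff_space K] /\
  [/\ {morph f : x y / x * y}, continuous f & dense (range f)].

Definition bohr_compactification (G B : preTopologicalGroupType) (b : G -> B) : Prop :=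
  compactification b /\
  forall (K : preTopologicalGroupType) (f : G -> K), compactification f ->
    exists! h : B -> K,
      [/\ {morph h : x y / x * y}, continuous h, range h = [set: K] & f = h \o b].

Definition von_neumann_radical (G B : preTopologicalGroupType) (b : G -> B) : set G :=
  [set x | b x = 1].

Definition topological_isomorphism (G K : preTopologicalGroupType) (f : G -> K) : Prop :=
  [/\ {morph f : x y / x * y}, continuous f
    & exists g : K -> G, [/\ cancel f g, cancel g f & continuous g]].

(* Main.v *)
Require Import Defs.
From HB Require Import structures.
From mathcomp Require Import all_boot finmap.
From mathcomp Require Import boolp classical_sets functions cardinality.
From mathcomp Require Import topology.

(* Each y in G^* determines a filter on bG, the image under b of its type over
   G.  By compactness it has a cluster point, and it converges there because the
   translates of the U_i by b(G) form a basis of bG whose traces on G are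
   definable.  The limit map st : G^* -> bG is a homomorphism extending b with
   kernel H.  By saturation st is surjective and maps sets type-definable over
   small sets onto closed sets, while preimages of closed sets are type-definable
   over G by regularity; hence G^*/H with the logic topology is bG.  Any other
   compactification is a continuous image h of bG, and H' is the kernel of
   h \o st. *)

Set Implicit Arguments.
Unset Strict Implicit.
Unset Printing Implicit Defensive.

Local Open Scope classical_set_scope.
Local Open Scope group_scope.

(** * Cardinals *)

(** Injective relations suit Zorn's lemma and unions of injections, since no map between subtypes
    has to be built; choice recovers one. *)
Lemma card_le_relP (T U : Type) (A : set T) (B : set U) :
  (A #<= B)%card <-> exists R : T -> U -> Prop,
    (forall x, A x -> exists2 y, B y & R x y) /\
    (forall x x' y, A x -> A x' -> R x y -> R x' y -> x = x').
Proof.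
split=> [/card_leP[f]|[R [Rtot Rinj]]].
  exists (fun x y => exists a : A, val a = x /\ val (f a) = y); split.
    move=> x Ax; exists (val (f (SigSub (mem_set Ax)))); first exact: set_valP.
    by exists (SigSub (mem_set Ax)).
  move=> x x' y _ _ [a [<- <-]] [a' [<- faa']]; congr val.
  by apply: ('inj_f); rewrite ?in_setT//; apply: val_inj.
have Rtot' (a : A) : exists u : B, R (val a) (val u).
  have [y By Ry] := Rtot _ (set_valP a).
  by exists (SigSub (mem_set By)).
have [f Rf] := choice Rtot'.
apply/card_leP/injfunPex; exists f => // a a' _ _ faa'.
apply: val_inj; apply: Rinj (set_valP a) (set_valP a') (Rf a) _.
by rewrite faa'; exact: Rf.
Qed.

(** A maximal partial injection [R] between [A] and [B] is total or onto: otherwise an unmatched [a]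
    and an unmatched [y] could be joined to it. *)
Lemma card_le_total (T U : Type) (A : set T) (B : set U) :
  (A #<= B)%card \/ (B #<= A)%card.
Proof.
pose P (R : set (T * U)) := [/\ R `<=` A `*` B,
  forall x y y', R (x, y) -> R (x, y') -> y = y'
  & forall x x' y, R (x, y) -> R (x', y) -> x = x'].
have [F FP totF|R [[RAB Rfun Rinj] Rmax]] := @Zorn_bigcup _ P.
  split=> [p [R FR Rp]|x y y' [R FR Rp] [R' FR' Rp']|x x' y [R FR Rp] [R' FR' Rp']].
  - by have [RAB _ _] := FP _ FR; exact: RAB.
  - have [RR'|R'R] := totF _ _ FR FR'.
      by have [_ Rf _] := FP _ FR'; exact: Rf (RR' _ Rp) Rp'.
    by have [_ Rf _] := FP _ FR; exact: Rf Rp (R'R _ Rp').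
  - have [RR'|R'R] := totF _ _ FR FR'.
      by have [_ _ Rf] := FP _ FR'; exact: Rf (RR' _ Rp) Rp'.
    by have [_ _ Rf] := FP _ FR; exact: Rf Rp (R'R _ Rp').
have [Atot|/existsNP[a /not_implyP[Aa na]]] :=
    pselect (forall x, A x -> exists y, R (x, y)).
  left; apply/card_le_relP; exists (fun x y => R (x, y)); split.
    by move=> x /Atot[y Rxy]; exists y => //; have [] := RAB _ Rxy.
  by move=> x x' y _ _; exact: Rinj.
right; apply/card_le_relP; exists (fun y x => R (x, y)); split; last first.
  by move=> y y' x _ _; exact: Rfun.
move=> y By; have [//|ny] := pselect (exists2 x, A x & R (x, y)).
have nRy x : ~ R (x, y).
  by move=> Rxy; apply: ny; exists x => //; have [] := RAB _ Rxy.
have nRa z : ~ R (a, z) by move=> Raz; apply: na; exists z.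
exfalso; apply: (Rmax (R `|` [set (a, y)])).
  split; first by move=> p; left.
  by move=> /(_ (a, y))/(_ (or_intror erefl))/nRa.
split.
- by move=> p [/RAB //|->].
- move=> x u v [Ru|[xa ua]] [Rv|[xa' va]].
  + exact: Rfun Ru Rv.
  + by rewrite xa' in Ru; have := nRa _ Ru.
  + by rewrite xa in Rv; have := nRa _ Rv.
  + by rewrite ua va.
- move=> u v z [Ru|[ua za]] [Rv|[va za']].
  + exact: Rinj Ru Rv.
  + by rewrite za' in Ru; have := nRy _ Ru.
  + by rewrite za in Rv; have := nRy _ Rv.
  + by rewrite ua va.
Qed.

(** [R] embeds two copies of [C], indexed by [bool], into [C]; [A] goes through the copy [false] and
    [B] through the copy [true]. *)
Lemma card_le_setU (T U : Type) (A B : set T) (C : set U)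
    (R : U -> bool -> U -> Prop) :
  (forall x c, C x -> exists2 y, C y & R x c y) ->
  (forall x c x' c' y, R x c y -> R x' c' y -> x = x' /\ c = c') ->
  (A #<= C)%card -> (B #<= C)%card -> (A `|` B #<= C)%card.
Proof.
move=> Rtot Rinj /card_le_relP[RA [RAtot RAinj]] /card_le_relP[RB [RBtot RBinj]].
apply/card_le_relP.
exists (fun x y => (A x /\ exists2 z, RA x z & R z false y) \/
                   (B x /\ exists2 z, RB x z & R z true y)); split.
  move=> x [Ax|Bx].
    have [z Cz RAz] := RAtot _ Ax; have [y Cy Ry] := Rtot z false Cz.
    by exists y => //; left; split=> //; exists z.
  have [z Cz RBz] := RBtot _ Bx; have [y Cy Ry] := Rtot z true Cz.
  by exists y => //; right; split=> //; exists z.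
move=> x x' y _ _ [] [Ax [z Rz Rzy]] [] [Ax' [z' Rz' Rzy']];
  have [zz' // _] := Rinj _ _ _ _ _ Rzy Rzy'; rewrite zz' in Rz.
- exact: RAinj Ax Ax' Rz Rz'.
- exact: RBinj Ax Ax' Rz Rz'.
Qed.

(* Zorn's lemma yields a maximal [X `<=` B] carrying an injection of two copies
   of [X] into [X]; by maximality [B `\` X] is finite. *)
Lemma infinite_doubling (T : Type) (B : set T) : infinite_set B ->
  exists (X : set T) (R : T -> bool -> T -> Prop),
    [/\ X `<=` B, finite_set (B `\` X),
      forall x c, X x -> exists2 y, X y & R x c y
    & forall x c x' c' y, R x c y -> R x' c' y -> x = x' /\ c = c'].
Proof.
move=> Binf.
pose dom (R : set (T * bool * T)) x := forall c, exists y, R (x, c, y).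
(* The first clause keeps sources and values inside the domain, so that [R] injects two copies of
   [dom R] into [dom R]. *)
pose P (R : set (T * bool * T)) := [/\
  forall x c y, R (x, c, y) -> [/\ B x, dom R x & dom R y],
  forall x c y y', R (x, c, y) -> R (x, c, y') -> y = y'
  & forall x c x' c' y, R (x, c, y) -> R (x', c', y) -> x = x' /\ c = c'].
have [F FP totF|R [[Rdom Rfun Rinj] Rmax]] := @Zorn_bigcup _ P.
  split=> [x c y [R FR Rp]|x c y y' [R FR Rp] [R' FR' Rp']
          |x c x' c' y [R FR Rp] [R' FR' Rp']].
  - have [Rd _ _] := FP _ FR; have [Bx dx dy] := Rd _ _ _ Rp.
    split=> // c'; first by have [z Rz] := dx c'; exists z, R.
    by have [z Rz] := dy c'; exists z, R.
  - have [RR'|R'R] := totF _ _ FR FR'.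
      by have [_ Rf _] := FP _ FR'; exact: Rf (RR' _ Rp) Rp'.
    by have [_ Rf _] := FP _ FR; exact: Rf Rp (R'R _ Rp').
  - have [RR'|R'R] := totF _ _ FR FR'.
      by have [_ _ Rf] := FP _ FR'; exact: Rf (RR' _ Rp) Rp'.
    by have [_ _ Rf] := FP _ FR; exact: Rf Rp (R'R _ Rp').
exists (dom R), (fun x c y => R (x, c, y)); split => //.
- by move=> x /(_ true)[y /Rdom[]].
- apply: contrapT => /infiniteP/card_le_relP[E [Etot Einj]].
  have Etot' n : exists y, (B `\` dom R) y /\ E n y.
    by have [y ? ?] := Etot n I; exists y.
  have [e eE] := choice Etot'.
  have e_inj : injective e.
    move=> m n emn; have [_ Em] := eE m; have [_ En] := eE n.
    by rewrite emn in Em; exact: Einj I I Em En.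
  have eB n : B (e n) by have [[]] := eE n.
  have eR n : ~ dom R (e n) by have [[]] := eE n.
  (* An infinite remainder contains a sequence [e], which is doubled by sending [(e n, c)] to
     [e (c + 2n)]; the parity of the index gives back [c]. Adding this to [R] contradicts
     maximality. *)
  pose N : set (T * bool * T) :=
    [set p | exists n c, p = (e n, c, e (nat_of_bool c + n.*2)%N)].
  have NP n (c : bool) : N (e n, c, e (c + n.*2)%N) by exists n, c.
  have Ndom n : dom N (e n) by move=> c; exists (e (c + n.*2)%N); exact: NP.
  have RNdom x c : ~ (exists n, e n = x /\ exists y, R (x, c, y)).
    by move=> [n [<- [y /Rdom[_ /eR]]]].
  have domRN x : dom R x -> dom (R `|` N) x.
    by move=> d c; have [y Ry] := d c; exists y; left.
  have domNR x : dom N x -> dom (R `|` N) x.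
    by move=> d c; have [y Ry] := d c; exists y; right.
  apply: (Rmax (R `|` N)).
    split; first by move=> p; left.
    move=> /(_ (e 0%N, false, e 0%N)) /(_ (or_intror (NP 0%N false))).
    by move=> /Rdom[_ /eR].
  split.
  + move=> x c y [/Rdom[Bx dx dy]|[n [c' [-> _ ->]]]].
      by split=> //; exact: domRN.
    by split; [exact: eB|exact/domNR/Ndom|exact/domNR/Ndom].
  + move=> x c y y' [Ry|[n [d [xn cd yn]]]] [Ry'|[n' [d' [xn' cd' yn']]]].
    * exact: Rfun Ry Ry'.
    * by exfalso; apply: (RNdom x c); exists n'; split=> //; exists y.
    * by exfalso; apply: (RNdom x c); exists n; split=> //; exists y'.
    * by rewrite yn yn' -cd -cd'; do 3 congr (_ _); apply: e_inj; rewrite -xn xn'.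
  + move=> x c x' c' y [Ry|[n [d [xn cd yn]]]] [Ry'|[n' [d' [xn' cd' yn']]]].
    * exact: Rinj Ry Ry'.
    * by have [_ _] := Rdom _ _ _ Ry; rewrite yn' => /eR.
    * by have [_ _] := Rdom _ _ _ Ry'; rewrite yn => /eR.
    * move: yn'; rewrite yn -cd -cd' => /e_inj cn.
      have cc' : c = c'.
        by have := congr1 odd cn; rewrite !oddD !odd_double !addbF !oddb.
      split=> //; rewrite xn xn'; congr e.
      by move: cn; rewrite cc' => /addnI/double_inj.
- move=> x c /(_ c)[y Ry]; exists y => //.
  by have [] := Rdom _ _ _ Ry.
Qed.

(** With [A] the smaller set, a finite [B] leaves the union finite and an infinite [B] absorbs [A]
    by doubling. This keeps a parameter set small after [range j] is adjoined. *)
Lemma card_lt_setU (T U : Type) (A B : set T) (C : set U) :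
  infinite_set C -> card_lt A C -> card_lt B C -> card_lt (A `|` B) C.
Proof.
move=> Cinf; wlog AB : A B / (A #<= B)%card => [wlg cA cB|cA cB].
  have [AB|BA] := card_le_total A B; first exact: wlg.
  by rewrite setUC; exact: wlg.
have [Bfin|Binf] := pselect (finite_set B).
  have ABfin : finite_set (A `|` B).
    by rewrite finite_setU; split=> //; exact: card_le_finite AB Bfin.
  have nCAB : ~ (C #<= A `|` B)%card.
    by move=> CAB; apply: Cinf; exact: card_le_finite CAB ABfin.
  by split=> //; have [|/nCAB] := card_le_total (A `|` B) C.
have [X [R [XB BXfin Rtot Rinj]]] := infinite_doubling Binf.
have Xinf : infinite_set X.
  by move=> Xfin; apply: Binf; rewrite -(setDUK XB) finite_setU.
(* [X] is infinite, so it absorbs the finitely many points of [B] outside it. *)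
have BX : (B #<= X)%card.
  rewrite -(setDUK XB); apply: card_le_setU Rtot Rinj _ _ => //.
  have [//|XF] := card_le_total (B `\` X) X.
  by exfalso; apply: Xinf; exact: card_le_finite XF BXfin.
have ABX : (A `|` B #<= B)%card.
  apply: card_le_trans (subset_card_le XB).
  by apply: card_le_setU Rtot Rinj _ _ => //; exact: card_le_trans AB BX.
have [BC nCB] := cB; split; first exact: card_le_trans ABX BC.
by move=> CAB; apply: nCB; exact: card_le_trans CAB ABX.
Qed.

Lemma card_le_lt_trans (T U V : Type) (A : set T) (B : set U) (C : set V) :
  (A #<= B)%card -> card_lt B C -> card_lt A C.
Proof.
move=> AB [BC nCB]; split=> [|CA]; first exact: card_le_trans AB BC.
by apply: nCB; exact: card_le_trans CA AB.
Qed.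

(** * Formulas and types *)

Lemma filter_bigcap_finite (T I : Type) (F : set_system T) (D : set I)
    (f : I -> set T) :
  Filter F -> finite_set D -> (forall i, D i -> F (f i)) ->
  F (\bigcap_(i in D) f i).
Proof.
move=> FF Dfin Ff.
have [X DX] := (@finite_fsetP {classic I} D).1 Dfin.
rewrite DX; apply: (@filter_bigI _ {classic I}) => i iX.
by apply: Ff; rewrite DX.
Qed.

Section Renaming.
Variable L : language.

Fixpoint term_rename (X Y : Type) (f : X -> Y) (t : term L X) : term L Y :=
  match t with
  | Var x => Var L (f x)
  | App g ts => App (fun i => term_rename f (ts i))
  end.

(** [omap f] fixes [None], the bound variable, so no capture can occur. *)
Fixpoint rename (X Y : Type) (f : X -> Y) (phi : formula L X) : formula L Y :=
  match phi with
  | Bot => Bot L Y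
  | Eq t u => Eq (term_rename f t) (term_rename f u)
  | Rel r ts => Rel (fun i => term_rename f (ts i))
  | Imp phi psi => Imp (rename f phi) (rename f psi)
  | All psi => All (rename (omap f) psi)
  end.

Definition Neg (X : Type) (phi : formula L X) := Imp phi (Bot L X).
Definition And (X : Type) (phi psi : formula L X) := Neg (Imp phi (Neg psi)).
Definition Ex (X : Type) (phi : formula L (option X)) := Neg (All (Neg phi)).

Variables (M : Type) (S : structure L M).

Lemma eval_rename (X Y : Type) (f : X -> Y) (v : Y -> M) (t : term L X) :
  Defs.eval S v (term_rename f t) = Defs.eval S (v \o f) t.
Proof.
elim: t => [//|g ts IH] /=; congr fsym_interp; exact/funext.
Qed.

Lemma sat_rename (X Y : Type) (f : X -> Y) (v : Y -> M) (phi : formula L X) :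
  sat S v (rename f phi) <-> sat S (v \o f) phi.
Proof.
elim: phi Y f v => {X} [X|X t u|X r ts|X phi IHphi psi IHpsi|X psi IH] Y f v /=.
- by [].
- by rewrite !eval_rename.
- by under eq_fun do rewrite eval_rename.
- by have := IHphi Y f v; have := IHpsi Y f v; tauto.
- have E x : oapp v x \o omap f = oapp (v \o f) x by apply/funext => -[].
  by split=> H x; have := H x; [move/IH; rewrite E|rewrite -E => /IH].
Qed.

Lemma sat_And (X : Type) (v : X -> M) (phi psi : formula L X) :
  sat S v (And phi psi) <-> sat S v phi /\ sat S v psi.
Proof.
by rewrite /=; have := EM (sat S v phi); have := EM (sat S v psi); tauto.
Qed.

Lemma sat_Ex (X : Type) (v : X -> M) (phi : formula L (option X)) :
  sat S v (Ex phi) <-> exists x, sat S (oapp v x) phi.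
Proof.
split=> /= [nall|[x vx] nall]; last exact: nall vx.
by apply: contrapT => nex; apply: nall => x vx; apply: nex; exists x.
Qed.

Lemma solutions_rename (P Q : Type) (f : P -> Q) (c : Q -> M)
    (phi : formula L (option P)) :
  solutions S c (rename (omap f) phi) = solutions S (c \o f) phi.
Proof.
apply/funext => x; rewrite /solutions /= (propext (sat_rename _ _ _)).
by congr sat; apply/funext => -[].
Qed.

(** Renaming along [c] turns names of parameters into elements of [A]. With [c] equal to [j],
    formulas over [G] become formulas over [range j]. *)
Lemma type_definable_family (P : Type) (c : P -> M) (A : set M)
    (p : set (formula L (option P))) :
  (forall a, A (c a)) ->
  type_definable_over S A (\bigcap_(phi in p) solutions S c phi).
Proof.
move=> cA; pose f a : A := SigSub (mem_set (cA a)).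
exists (rename (omap f) @` p); rewrite bigcap_image.
by apply: eq_bigcapr => phi _; rewrite solutions_rename.
Qed.

End Renaming.

(** * Formulas for translates and products of definable sets *)

Section GroupFormulas.
Variable L : language.
Local Notation LG := (group_language L).

Definition mul_term (X : Type) (t u : term LG X) : term LG X :=
  @App LG X (None : Defs.fsym LG) (fun i : 'I_2 => if i == ord0 then t else u).

Definition translate_formula (P : Type) (a : P) (phi : formula LG (option P)) :
    formula LG (option P) :=
  Ex (And (rename (oapp (Some \o Some) None) phi)
          (Eq (Var LG (Some None))
              (mul_term (Var LG (Some (Some a))) (Var LG None)))).

(** Under the two quantifiers, [Some (Some None)] is the original variable, [Some None] the left
    factor and [None] the right factor. *)
Definition product_formula (P : Type) (phi psi : formula LG (option P)) :
    formula LG (option P) :=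
  Ex (Ex (And (And (rename (oapp (Some \o Some \o Some) (Some None)) phi)
                   (rename (oapp (Some \o Some \o Some) None) psi))
              (Eq (Var LG (Some (Some None)))
                  (mul_term (Var LG (Some None)) (Var LG None))))).

Variables (M : groupType) (S : structure L M) (P : Type) (c : P -> M).
Local Notation sol := (solutions (group_structure S) c).

Lemma solutions_translate a phi :
  sol (translate_formula a phi) = [set x | sol phi ((c a)^-1 * x)].
Proof.
apply/seteqP; split=> x; rewrite /solutions /mkset.
  move=> /sat_Ex[u /sat_And[/sat_rename phiu]].
  rewrite /= => ->; rewrite mulKg.
  by move: phiu; congr sat; apply/funext => -[].
move=> phiu; apply/sat_Ex; exists ((c a)^-1 * x); apply/sat_And; split.
  by apply/sat_rename; move: phiu; congr sat; apply/funext => -[].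
by rewrite /= mulVKg.
Qed.

Lemma solutions_product phi psi :
  sol (product_formula phi psi) =
  [set x | exists u v, [/\ sol phi u, sol psi v & x = u * v]].
Proof.
apply/seteqP; split=> x; rewrite /solutions /mkset.
  move=> /sat_Ex[u /sat_Ex[v /sat_And[/sat_And[/sat_rename hu /sat_rename hv]]]].
  rewrite /= => ->; exists u, v; split=> //.
    by move: hu; congr sat; apply/funext => -[].
  by move: hv; congr sat; apply/funext => -[].
move=> [u [v [hu hv ->]]]; apply/sat_Ex; exists u; apply/sat_Ex; exists v.
apply/sat_And; split=> //; apply/sat_And; split; apply/sat_rename.
  by move: hu; congr sat; apply/funext => -[].
by move: hv; congr sat; apply/funext => -[].
Qed.

End GroupFormulas.

(** * The standard part map *)

Section StandardPart.
Variables (L : language) (G : groupType) (S : structure L G).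
Variables (Gs : groupType) (Ss : structure L Gs) (j : G -> Gs).
Local Notation LG := (group_language L).
Local Notation SG := (group_structure S).
Local Notation SGs := (group_structure Ss).
Hypothesis hj : elementary_embedding SG SGs j.

Lemma elementary_forall (phi : formula LG (option G)) :
  (forall x, solutions SG id phi x) <-> (forall y, solutions SGs j phi y).
Proof. exact: (hj (All phi)). Qed.

(** An inclusion is the universal closure of an implication. All later uses of elementarity pass
    through this transfer. *)
Lemma elementary_sub (phi psi : formula LG (option G)) :
  solutions SG id phi `<=` solutions SG id psi ->
  solutions SGs j phi `<=` solutions SGs j psi.
Proof. exact: (elementary_forall (Imp phi psi)).1. Qed.

Variables (B : preTopologicalGroupType) (b : G -> B).

(* The image under [b] of the type of [y] over [G]. *)
Definition type_filter (y : Gs) : set_system B :=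
  [set W | exists2 chi : formula LG (option G),
     solutions SGs j chi y & solutions SG id chi `<=` b @^-1` W].

(** An empty member would yield a formula true at [y] without solutions in [G], against
    elementarity. Conjunctions give finite intersections. *)
Instance type_filter_proper (y : Gs) : ProperFilter (type_filter y).
Proof.
apply: Build_ProperFilter_ex => [W [chi chiy chiW]|].
  apply: contrapT => W0.
  have : solutions SG id chi `<=` solutions SG id (Bot LG (option G)).
    by move=> x /chiW Wx; apply: W0; exists (b x).
  by move/elementary_sub => /(_ y chiy).
split.
- by exists (Neg (Bot LG (option G))).
- move=> W W' [phi phiy phiW] [psi psiy psiW']; exists (And phi psi).
    exact/sat_And.
  by move=> x /sat_And[/phiW Wx /psiW' W'x].
- by move=> W W' WW' [phi phiy phiW]; exists phi => // x /phiW/WW'.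
Qed.

(** This is what the construction of the standard part needs from the [U_i]: arbitrarily small open
    neighbourhoods with definable traces on [G]. *)
Definition definable_base := forall z (W : set B), nbhs z W ->
  exists O (phi : formula LG (option G)),
    [/\ open_nbhs z O, O `<=` W & b @^-1` O = solutions SG id phi].

Hypothesis compactB : compact [set: B].
Hypothesis hausdorffB : hausdorff_space B.
Hypothesis baseB : definable_base.

(* Either [phi] or its negation belongs to the type of [y], so a cluster point
   of [type_filter y] is a limit. *)
Lemma type_filter_cvg y : exists z : B, nbhs z `<=` type_filter y.
Proof.
have [z [_ clz]] := compactB (type_filter_proper y) filterT.
exists z => W /baseB[O [phi [Oz OW bO]]].
have [phiy|nphiy] := pselect (solutions SGs j phi y).
  by exists phi => //; rewrite -bO => x; exact: OW.
have FnO : type_filter y (~` O).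
  exists (Neg phi) => // x nphi Ox; apply: nphi.
  by have : (b @^-1` O) x by []; rewrite bO.
by have [x []] := clz _ _ FnO (open_nbhs_nbhs Oz).
Qed.

Variable st : Gs -> B.
Hypothesis st_cvg : forall y, nbhs (st y) `<=` type_filter y.

(** Two limits of a proper filter in a Hausdorff space coincide; values of [st] are computed below
    by exhibiting a limit. *)
Lemma st_unique y z : nbhs z `<=` type_filter y -> st y = z.
Proof.
move=> Fz; apply: hausdorffB => V W /st_cvg FV /Fz FW.
exact: (filter_ex (filterI FV FW)).
Qed.

(** If [phi] and [psi] hold at [y] and [y'], their product formula holds at [y * y']; joint
    continuity then makes [st y * st y'] a limit for [y * y']. *)
Lemma stM (mulB : continuous (fun xy : B * B => xy.1 * xy.2))
  (bM : {morph b : x y / x * y}) : {morph st : x y / x * y}.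
Proof.
move=> y y'; apply: st_unique => W nW.
have [[V V'] /= [nV nV'] VW] := mulB (st y, st y') W nW.
have [phi phiy phiV] := st_cvg nV; have [psi psiy psiV'] := st_cvg nV'.
exists (product_formula phi psi).
  by rewrite solutions_product; exists y, y'.
rewrite solutions_product => _ [u [v [/phiV Vu /psiV' Vv ->]]].
by rewrite /= bM; exact: (VW (b u, b v)).
Qed.

Lemma st_j g : st (j g) = b g.
Proof.
apply: st_unique => W nW; exists (Eq (Var LG None) (Var LG (Some g))) => //.
by move=> x; rewrite /solutions /= => ->; exact: nbhs_singleton.
Qed.

(** Convergence provides a formula true at [y] whose solutions in [G] map into [O], hence satisfy
    [phi]; this inclusion transfers to [Gs]. *)
Lemma st_solutions y (O : set B) (phi : formula LG (option G)) :
  open O -> b @^-1` O `<=` solutions SG id phi -> O (st y) ->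
  solutions SGs j phi y.
Proof.
move=> oO bO Oy; have [chi chiy chiO] := st_cvg (open_nbhs_nbhs (conj oO Oy)).
by apply: elementary_sub chiy; exact: subset_trans bO.
Qed.

(** The defining type [p] collects every formula over [G] valid on the preimage. A point [y] outside
    is excluded by the negation of a definable neighbourhood of [st y] whose closure, by regularity,
    misses [C]. *)
Lemma type_definable_st_preimage (C : set B) : closed C ->
  type_definable_over SGs (range j) (st @^-1` C).
Proof.
move=> cC; pose p := [set phi | st @^-1` C `<=` solutions SGs j phi].
suff -> : st @^-1` C = \bigcap_(phi in p) solutions SGs j phi.
  by apply: type_definable_family => g; exists g.
apply/seteqP; split=> [y Cy phi|y py]; first exact.
apply: contrapT => nCy.
have nC : nbhs (st y) (~` C).
  by apply: open_nbhs_nbhs; split=> //; exact: closed_openC.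
have [W nW WC] := compact_regular hausdorffB compactB filterT nC.
have [O [phi [[oO Oy] OW bO]]] := baseB nW.
have phiy : solutions SGs j phi y by apply: st_solutions oO _ Oy; rewrite bO.
have /py : p (Neg phi); last exact.
(* The complement of [closure W] is an open set around [st y'] whose trace on [G] avoids [phi]. *)
move=> y' Cy'; apply: (@st_solutions y' (~` closure W)).
- exact/closed_openC/closed_closure.
- move=> x /= nWx phix; apply: nWx; apply: subset_closure; apply: OW.
  by rewrite -[O _]/((b @^-1` O) x) bO.
- by move=> /WC.
Qed.

Variable kappa : Type.
Hypothesis kappa_inf : infinite_set [set: kappa].
Hypothesis kappa_G : card_lt [set: G] [set: kappa].
Hypothesis sat_Gs : saturated SGs kappa.

Lemma small_range : small kappa (range j).
Proof. exact: card_le_lt_trans (card_image_le j _) kappa_G. Qed.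

(** For [z] in the closure, saturation realizes together the type defining [P] and the formulas of
    definable neighbourhoods of [z]; a realization lies in [P] and has standard part [z]. *)
Lemma closed_st_image (P : set Gs) : small_type_definable SGs kappa P ->
  closed (st @` P).
Proof.
move=> [A [smallA [p Pp]]] z clz.
pose A' := A `|` range j.
have fA (a : A) : A' (val a) by left; exact: set_valP.
have gA (g : G) : A' (j g) by right; exists g.
pose f a : A' := SigSub (mem_set (fA a)).
pose g a : A' := SigSub (mem_set (gA a)).
pose p' := [set phi | exists2 O, open_nbhs z O & b @^-1` O = solutions SG id phi].
pose q := rename (omap f) @` p `|` rename (omap g) @` p'.
have smallA' : small kappa A' by exact: card_lt_setU kappa_inf smallA small_range.
have [q0 q0fin q0q|y qy] := sat_Gs (p := q) smallA'.
  (* Finite satisfiability: near [z], every point of [P] with the given standard part satisfies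
     [q0], and such points exist because [z] is in the closure. *)
  have nq0 : nbhs z (\bigcap_(psi in q0)
      [set d | forall y, P y -> st y = d -> solutions SGs val psi y]).
    apply: filter_bigcap_finite => // _ /q0q[[phi pphi <-]|[phi [O Oz bO] <-]].
      apply: filterE => d y Py _; rewrite solutions_rename.
      by move: Py; rewrite Pp; exact.
    apply: filterS (open_nbhs_nbhs Oz) => d Od y _ yd; rewrite solutions_rename.
    by apply: st_solutions Oz.1 _ _; [rewrite bO|rewrite yd].
  have [_ [[y Py <-] q0y]] := clz _ nq0.
  by exists y => psi /q0y; exact.
exists y.
  rewrite Pp => phi pphi.
  have := qy (rename (omap f) phi); rewrite solutions_rename; apply.
  by left; exists phi.
apply: st_unique => W /baseB[O [phi [Oz OW bO]]].
exists phi; last by rewrite -bO => x; exact: OW.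
have := qy (rename (omap g) phi); rewrite solutions_rename; apply.
by right; exists phi => //; exists O.
Qed.

(** The range is closed, as the image of the whole of [Gs], and contains the dense set [range b]. *)
Lemma st_surjective : dense (range b) -> range st = setT.
Proof.
move=> dense_b; have /closure_id -> : closed (range st).
  apply: closed_st_image; exists (range j); split; first exact: small_range.
  (* The empty set of formulas defines the whole of [Gs]. *)
  by exists set0; rewrite bigcap_set0.
apply/seteqP; split=> // z _ W; rewrite nbhsE => -[O [oO Oz] OW].
have [z' [Oz' [x _ bx]]] := dense_b O (ex_intro _ z Oz) oO.
exists (b x); split; first by exists (j x) => //; rewrite st_j.
by apply: OW; rewrite bx.
Qed.

Lemma closed_st_preimage (C : set B) : range st = setT ->
  closed C <-> small_type_definable SGs kappa (st @^-1` C).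
Proof.
move=> st_surj; split=> [cC|/closed_st_image].
  by exists (range j); split; [exact: small_range|exact: type_definable_st_preimage].
by rewrite image_preimage.
Qed.

End StandardPart.

(** * Compact quotients *)

Section GroupMorphism.
Variables (G K : groupType) (f : G -> K).
Hypothesis fM : {morph f : x y / x * y}.

Lemma morph_group1 : f 1 = 1.
Proof. by apply: (mulgI (f 1)); rewrite -fM !mulg1. Qed.

Lemma morph_groupV x : f x^-1 = (f x)^-1.
Proof. by apply: (mulgI (f x)); rewrite -fM !mulgV morph_group1. Qed.

Lemma normal_kernel : normal_subgroup (f @^-1` [set 1]).
Proof.
split=> [|x y /= fx fy|x /= fx|x y /= fx].
- exact: morph_group1.
- by rewrite fM fx fy mulg1.
- by rewrite morph_groupV fx invg1.
- by rewrite /conjg !fM fx mul1g morph_groupV mulVg.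
Qed.

End GroupMorphism.

Section KernelQuotient.
Variables (kappa : Type) (L : language) (G : groupType) (S : structure L G).
Variables (K : preTopologicalGroupType) (f : G -> K).
Hypothesis fM : {morph f : x y / x * y}.
Hypothesis f_surj : range f = setT.
Hypothesis f_closed : forall C : set K,
  closed C <-> small_type_definable S kappa (f @^-1` C).
Variable hN : normal_subgroup (f @^-1` [set 1]).
Local Notation Q := (logic_quotient kappa S hN).

Lemma closed_logic_closed (C : set Q) : logic_closed kappa S C -> closed C.
Proof.
move=> lC; rewrite -openC; exists [set ~` C]; last by rewrite bigcup_set1.
move=> _ ->; exists [fset C]%fset.
  by move=> D; rewrite in_fset1 => /eqP ->; exact: mem_set.
by rewrite set_fset1 bigcap_set1.
Qed.

(** Open sets of [Q] are unions of finite intersections of complements of logic-closed sets, so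
    testing these suffices. *)
Lemma continuous_logic_quotient (T : topologicalType) (g : T -> Q) :
  (forall C : set Q, logic_closed kappa S C -> closed (g @^-1` C)) ->
  continuous g.
Proof.
move=> gC; apply/continuousP => _ [D sD <-].
rewrite preimage_bigcup; apply: bigcup_open => _ /sD[E sE <-].
rewrite preimage_bigcap; rewrite openE => x Ex.
apply: filter_bigI => C CE; apply: open_nbhs_nbhs; split; last exact: Ex.
by rewrite -preimage_setC; apply: closed_openC; apply: gC; exact/set_mem/sE.
Qed.

(** The bijection induced by [f] matches logic-closed sets with closed sets of [K], by [f_closed].
    As the latter already form a topology, passing to the generated topology adds no closed sets. *)
Lemma kernel_quotient_iso :
  has_logic_topology kappa S hN /\
  exists theta : Q -> K,
    topological_isomorphism theta /\ theta \o quotient_map hN = f.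
Proof.
pose theta (a : Q) := f (repr (a : quotient hN)).
have thetaE x : theta (quotient_map hN x) = f x.
  have /= := repr_quotient_map hN x; rewrite fM morph_groupV // => fx.
  by rewrite -[RHS](mulVKg (theta (quotient_map hN x))) fx mulg1.
have f_pre k : exists x, f x = k.
  have : range f k by rewrite f_surj.
  by case=> x _; exists x.
have [s fs] := choice f_pre.
pose g k : Q := quotient_map hN (s k).
have gf x : g (f x) = quotient_map hN x.
  by apply/quotient_mapP; rewrite /= fM morph_groupV // fs mulVg.
have gK : cancel g theta by move=> k; rewrite thetaE fs.
have thetaK : cancel theta g.
  by elim/quotient_mapW => x; rewrite thetaE gf.
(* [C] and its preimage under [g] have the same preimage in [G]. *)
have logicE (C : set Q) : logic_closed kappa S C <-> closed (g @^-1` C).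
  rewrite f_closed /logic_closed.
  suff -> : f @^-1` (g @^-1` C) = quotient_map hN @^-1` C by [].
  by apply/funext => x; rewrite /preimage /= gf.
have g_cont : continuous g by apply: continuous_logic_quotient => C /logicE.
split=> [C|].
  split=> [cC|/closed_logic_closed //].
  by apply/logicE; exact: (continuous_closedP _).1 g_cont _ cC.
exists theta; split; last exact/funext.
split.
- elim/quotient_mapW => x; elim/quotient_mapW => y.
  have -> : (quotient_map hN x : Q) * (quotient_map hN y : Q) =
      quotient_map hN (x * y) by exact: quotientM_map.
  by rewrite !thetaE fM.
- apply/continuous_closedP => C cC; apply: closed_logic_closed; apply/logicE.
  suff -> : g @^-1` (theta @^-1` C) = C by [].
  by apply/funext => k; rewrite /preimage /= gK.
- by exists g.
Qed.

Lemma bounded_kernel_quotient :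
  card_lt [set: K] [set: kappa] -> bounded_index hN kappa.
Proof.
apply: card_le_lt_trans.
have [_ [theta [[_ _ [g [thetaK _ _]]] _]]] := kernel_quotient_iso.
have <- : g @` [set: K] = [set: quotient hN]; last exact: card_image_le.
by apply/seteqP; split=> // a _; exists (theta a).
Qed.

End KernelQuotient.

(** * Transport of compactifications along topological isomorphisms *)

Lemma topological_isomorphism_compactification
    (G Q B : preTopologicalGroupType) (theta : Q -> B) (n : G -> Q) :
  topological_isomorphism theta -> compactification (theta \o n) ->
  compactification n.
Proof.
move=> [thetaM theta_cont [g [thetaK gK g_cont]]].
move=> [[[mulB invB] compactB hausB] [bM b_cont b_dense]].
have nE : n = g \o (theta \o n) by apply/funext => x /=; rewrite thetaK.
split; split.
- split.
  + have -> : (fun xy : Q * Q => xy.1 * xy.2) =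
        g \o (fun xy : B * B => xy.1 * xy.2) \o
        (fun xy => (theta xy.1, theta xy.2)).
      by apply/funext => xy /=; rewrite -thetaM thetaK.
    move=> xy; apply: continuous_comp; last first.
      by apply: continuous_comp; [exact: mulB|exact: g_cont].
    by apply: cvg_pair => /=; apply: (continuous_comp _ (theta_cont _));
      [exact: cvg_fst|exact: cvg_snd].
  + have -> : (fun x : Q => x^-1) = g \o (fun x : B => x^-1) \o theta.
      by apply/funext => x /=; rewrite -(morph_groupV thetaM) thetaK.
    move=> x; apply: continuous_comp; first exact: theta_cont.
    by apply: continuous_comp; [exact: invB|exact: g_cont].
- have -> : [set: Q] = g @` [set: B].
    by apply/seteqP; split=> // a _; exists (theta a).
  by apply: continuous_compact => //; exact: continuous_subspaceT.
- move=> p q clpq; apply: (can_inj thetaK); apply: hausB => V W nV nW.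
  have [r [Vr Wr]] := clpq _ _ (theta_cont p _ nV) (theta_cont q _ nW).
  by exists (theta r).
- move=> x y; apply: (can_inj thetaK); rewrite thetaM; exact: bM.
- by rewrite nE => x; apply: continuous_comp; [exact: b_cont|exact: g_cont].
- move=> O [a Oa] oO.
  have [|k [Ok [x _ xk]]] := b_dense (g @^-1` O) _ ((continuousP _).1 g_cont _ oO).
    by exists (theta a); rewrite /preimage /= thetaK.
  by exists (n x); split;
    [move: Ok; rewrite /preimage /= -xk /= thetaK|exists x].
Qed.

(** Factorizations through [B] and through [Q] correspond by composing with [theta] and its inverse,
    which carries over both existence and uniqueness. *)
Lemma topological_isomorphism_bohr
    (G Q B : preTopologicalGroupType) (theta : Q -> B) (n : G -> Q) :
  topological_isomorphism theta -> bohr_compactification (theta \o n) ->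
  bohr_compactification n.
Proof.
move=> theta_iso [cb bU]; split.
  exact: topological_isomorphism_compactification theta_iso cb.
move: theta_iso => [thetaM theta_cont [g [thetaK gK g_cont]]] K f cf.
have [h [[hM h_cont h_surj fE] h_uniq]] := bU K f cf.
exists (h \o theta); split.
  split=> //.
  - by move=> x y /=; rewrite thetaM hM.
  - by move=> x; apply: continuous_comp; [exact: theta_cont|exact: h_cont].
  - apply/seteqP; split=> // k _; have : range h k by rewrite h_surj.
    by case=> z _ <-; exists (g z) => //=; rewrite gK.
move=> h' [h'M h'_cont h'_surj f'E].
rewrite (h_uniq (h' \o g)); first by apply/funext => x /=; rewrite thetaK.
split.
- move=> x y /=; rewrite -h'M; congr h'; apply: (can_inj thetaK).
  by rewrite thetaM !gK.
- by move=> x; apply: continuous_comp; [exact: g_cont|exact: h'_cont].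
- apply/seteqP; split=> // k _; have : range h' k by rewrite h'_surj.
  by case=> z _ <-; exists (theta z) => //=; rewrite thetaK.
- by rewrite f'E; apply/funext => x /=; rewrite thetaK.
Qed.

(** By surjectivity [C] is the image of its preimage; if the latter is closed it is compact, so [C]
    is compact in a Hausdorff space. *)
Lemma closed_preimage_surjective (B K : topologicalType) (h : B -> K)
    (C : set K) :
  compact [set: B] -> hausdorff_space K -> continuous h -> range h = setT ->
  closed (h @^-1` C) <-> closed C.
Proof.
move=> cB hK h_cont h_surj; split=> [cC|]; last exact: (continuous_closedP _).1.
rewrite -(image_preimage C h_surj); apply: compact_closed => //.
apply: continuous_compact; first exact: continuous_subspaceT.
exact: subclosed_compact cC cB _.
Qed.

(** A translate of [U i] by [z] itself may have no definable trace, so [z] is replaced by a nearby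
    [b g], found by density. *)
Lemma definable_translate_base (L : language) (G : groupType)
    (S : structure L G) (B : preTopologicalGroupType) (b : G -> B)
    (I : Type) (U : I -> set B) :
  topological_group B -> {morph b : x y / x * y} -> dense (range b) ->
  (forall i, open (U i)) -> (forall i, U i 1) ->
  (forall W : set B, nbhs 1 W -> exists i, U i `<=` W) ->
  (forall i, U i = [set x^-1 | x in U i]) ->
  (forall i, definable (group_structure S) (b @^-1` U i)) ->
  definable_base S b.
Proof.
move=> [mulB invB] bM b_dense U_open U_one U_basis U_inv V_def z W nW.
have contL (a : B) : continuous (fun x : B => a * x).
  move=> x; apply: (@continuous_comp _ _ _ (fun x => (a, x)) _ x _ (mulB _)).
  by apply: cvg_pair; [exact: cvg_cst|exact: cvg_id].
have openL (a : B) (O : set B) : open O -> open [set x | O (a * x)].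
  exact: (continuousP _).1 (contL a) O.
(* Continuity at [(1, 1)] yields [U i] with [z * (u * v)] in [W] for all [u], [v] in [U i]. *)
have contz : {for (1, 1), continuous (fun xy : B * B => z * (xy.1 * xy.2))}.
  by apply: continuous_comp; [exact: mulB|exact: contL].
have := contz W; rewrite /= !mulg1 => /(_ nW)[[W1 W2] /= [nW1 nW2] W12].
have [i UiW] := U_basis _ (filterI nW1 nW2).
have [|k [Ug [g _ gk]]] := b_dense _ _ (openL z^-1 _ (U_open i)).
  by exists z; rewrite /= mulVg.
rewrite -{}gk {k} /= in Ug.
have [phi Vphi] := V_def i.
exists [set x | U i ((b g)^-1 * x)], (translate_formula g phi); split.
- split; first exact: openL.
  (* Symmetry of [U i] turns [z^-1 * b g] in [U i] into [z] in the translate by [b g]. *)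
  by rewrite /= U_inv; exists (z^-1 * b g) => //; rewrite invgM invgK.
- move=> x /= Ux; have := W12 (z^-1 * b g, (b g)^-1 * x).
  rewrite /= -mulgA mulVKg mulVKg; apply; split=> /=.
    by have [] := UiW _ Ug.
  by have [] := UiW _ Ux.
- rewrite solutions_translate -Vphi; apply/funext => x.
  by rewrite /preimage /= bM (morph_groupV bM).
Qed.

(** Membership in every interpretation makes [1] a limit of the type of [y]; conversely, if
    [st y = 1], openness of each [U i] transfers its defining formula to [y]. *)
Lemma interpretation_kernel (L : language) (G Gs : groupType)
    (S : structure L G) (Ss : structure L Gs) (j : G -> Gs)
    (B : preTopologicalGroupType) (b : G -> B) (st : Gs -> B)
    (I : Type) (U : I -> set B) :
  elementary_embedding (group_structure S) (group_structure Ss) j ->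
  hausdorff_space B ->
  (forall y, nbhs (st y) `<=` type_filter S Ss j b y) ->
  (forall i, open (U i)) -> (forall i, U i 1) ->
  (forall W : set B, nbhs 1 W -> exists i, U i `<=` W) ->
  (forall i, definable (group_structure S) (b @^-1` U i)) ->
  \bigcap_(i in [set: I]) interpretation (group_structure S)
    (group_structure Ss) j (b @^-1` U i) = st @^-1` [set 1].
Proof.
move=> hj hausB st_cvg U_open U_one U_basis V_def.
apply/seteqP; split=> y.
  move=> Hy; apply: (st_unique hj hausB st_cvg) => W /U_basis[i UiW].
  have [phi [Vphi phiy]] := Hy i Logic.I.
  by exists phi => //; rewrite -Vphi => x /UiW.
move=> y1 i _; have [phi Vphi] := V_def i.
exists phi; split=> //.
by apply: (st_solutions hj st_cvg (U_open i)); rewrite ?Vphi// y1.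
Qed.

Theorem theorem5p6
  (G : preTopologicalGroupType)
  (hG : topological_group G) (hausG : hausdorff_space G)
  (L : language) (S : structure L G)
  (bG : preTopologicalGroupType) (b : G -> bG) (hb : bohr_compactification b)
  (I : Type) (U : I -> set bG)
  (U_open : forall i, open (U i))
  (U_one : forall i, U i 1)
  (U_basis : forall W : set bG, nbhs 1 W -> exists i, U i `<=` W)
  (U_cap : forall i j, exists k, U k = U i `&` U j)
  (U_sqr : forall i, exists j,
     [set x * y | x in closure (U j) & y in closure (U j)] `<=` U i)
  (U_inv : forall i, U i = [set x^-1 | x in U i])
  (U_conj : forall i (x : bG), [set x^-1 * y * x | y in U i] = U i)
  (R_def : definable (group_structure S) (von_neumann_radical b))
  (V_def : forall i, definable (group_structure S) (b @^-1` U i))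
  (kappa : Type)
  (kappa_inf : infinite_set [set: kappa])
  (kappa_G : card_lt [set: G] [set: kappa])
  (kappa_bG : card_lt [set: bG] [set: kappa])
  (Gs : groupType) (Ss : structure L Gs) (j : G -> Gs)
  (hj : elementary_embedding (group_structure S) (group_structure Ss) j)
  (sat_Gs : saturated (group_structure Ss) kappa)
  (hom_Gs : strongly_homogeneous (group_structure Ss) kappa)
  (H : set Gs)
  (H_eq : H = \bigcap_(i in [set: I])
     interpretation (group_structure S) (group_structure Ss) j (b @^-1` U i)) :
  (exists hH : normal_subgroup H,
     [/\ type_definable_over (group_structure Ss) (range j) H,
         bounded_index hH kappa,
         has_logic_topology kappa (group_structure Ss) hH
       & bohr_compactification (natural_map kappa (group_structure Ss) hH j)]) /\
  (forall (K : preTopologicalGroupType) (f : G -> K), compactification f ->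
     exists (H' : set Gs) (hH' : normal_subgroup H'),
       [/\ type_definable_over (group_structure Ss) (range j) H',
           H `<=` H',
           bounded_index hH' kappa,
           has_logic_topology kappa (group_structure Ss) hH'
         & exists theta : logic_quotient kappa (group_structure Ss) hH' -> K,
             topological_isomorphism theta /\
             theta \o natural_map kappa (group_structure Ss) hH' j = f]).
Proof.
have [[[[mulB invB] compactB hausB] [bM b_cont b_dense]] bU] := hb.
have baseB : definable_base S b.
  exact: definable_translate_base U_open U_one U_basis U_inv V_def.
have [st st_cvg] := choice (type_filter_cvg hj compactB baseB).
have stM := stM hj hausB st_cvg mulB bM.
have stj := st_j hj hausB st_cvg.
have st_surj : range st = setT.
  exact: (st_surjective hj hausB baseB st_cvg kappa_inf kappa_G sat_Gs b_dense).
have st_closed C :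
    closed C <-> small_type_definable (group_structure Ss) kappa (st @^-1` C).
  exact: (closed_st_preimage hj compactB hausB baseB st_cvg kappa_inf kappa_G
    sat_Gs).
have st_td := type_definable_st_preimage hj compactB hausB baseB st_cvg.
have HE : H = st @^-1` [set 1].
  by rewrite H_eq; exact: interpretation_kernel.
split.
  rewrite HE; exists (normal_kernel stM).
  have [logicQ [theta [theta_iso thetaE]]] :=
    kernel_quotient_iso stM st_surj st_closed (normal_kernel stM).
  split=> //.
  - exact/st_td/accessible_closed_set1/hausdorff_accessible.
  - exact: bounded_kernel_quotient stM st_surj st_closed _ kappa_bG.
  - apply: (topological_isomorphism_bohr theta_iso).
    suff -> : theta \o natural_map kappa (group_structure Ss) _ j = b by [].
    by apply/funext => x; rewrite -stj -[in RHS]thetaE.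
move=> K f cf; have [h [[hM h_cont h_surj fE] _]] := bU K f cf.
have [[_ _ hausK] _] := cf.
pose f' := h \o st.
have f'M : {morph f' : x y / x * y} by move=> x y; rewrite /f' /= stM hM.
have f'_surj : range f' = setT by rewrite -(image_comp st h) st_surj.
have f'_closed C :
    closed C <-> small_type_definable (group_structure Ss) kappa (f' @^-1` C).
  (* As a continuous surjection from a compact space to a Hausdorff one, [h] detects closed sets of
     [K] on [bG], and [st] then detects them on [Gs]. *)
  rewrite -(closed_preimage_surjective _ compactB hausK h_cont h_surj).
  exact: st_closed.
have hN := normal_kernel f'M.
have [logicQ [theta [theta_iso thetaE]]] :=
  kernel_quotient_iso f'M f'_surj f'_closed hN.
exists (f' @^-1` [set 1]), hN; split=> //.
(* The kernel of [f'] is the preimage under [st] of the closed kernel of [h]. *)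
- apply: (st_td (h @^-1` [set 1])).
  apply: (continuous_closedP _).1 h_cont _ _.
  exact/accessible_closed_set1/hausdorff_accessible.
- by rewrite HE => y /= y1; rewrite /f' /= y1 morph_group1.
- apply: bounded_kernel_quotient f'M f'_surj f'_closed _ _.
  by apply: card_le_lt_trans kappa_bG; rewrite -h_surj; exact: card_image_le.
- exists theta; split=> //; apply/funext => x; rewrite fE /= -stj.
  exact: (congr1 (fun u : Gs -> K => u (j x)) thetaE).
Qed.
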